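(* Let $L$ be a closed linear operator on a complex Hilbert space $H$ satisfying the standing assumptions listed in the context, with linearly independent slow eigenvectors $\hat{x}_1,\dots,\hat{x}_n$, $L\hat{x}_j=\lambda_j\hat{x}_j$. Let $G_{ij}=\dfrac{\langle\hat{x}_i,\hat{x}_j\rangle}{\lambda_i+\lambda_j^*}$, $1\le i,j\le n$, and $$\mathbb{P}_{\rm DOP}\,x=\sum_{i=1}^n\sum_{j=1}^n\hat{x}_i\left[(G^{T})^{-1}\right]_{ij}\big\langle (L+\lambda_j^* )^{-1}x,\hat{x}_j\big\rangle,\qquad x\in H.$$ Assume that $L$ is normal. Then $\mathbb{P}_{\rm DOP}$ is the orthogonal projection of $H$ onto $\mathrm{span}\{\hat{x}_1,\dots,\hat{x}_n\}$. If moreover the eigenvalues $\lambda_1,\dots,\lambda_n$ are simple and the eigenvectors $\hat{x}_j$ have unit length, then $G$ is diagonal, with $$G_{ij}=\frac{1}{2\Re\lambda_i}\,\delta_{ij},\qquad 1\le i,j\le n,$$ and $$\mathbb{P}_{\rm DOP}\,x=\sum_{j=1}^n\langle x,\hat{x}_j\rangle\,\hat{x}_j\qquad\text{for all }x\in H.$$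
   Context: $H$ is a complex Hilbert space with inner product $\langle\cdot,\cdot\rangle$, linear in the first argument and conjugate-linear in the second, and norm $\|\cdot\|$. A star denotes complex conjugation of scalars, $G^T$ is the (non-conjugated) transpose, $\delta_{ij}$ is Kronecker's delta, and $L^\dagger$ is the Hilbert space adjoint of $L$. $L$ is normal if it commutes with its adjoint, $LL^\dagger=L^\dagger L$ (equality of operators including domains). For a scalar $\mu$, $L+\mu$ means $L+\mu\,\mathrm{Id}$. Standing assumptions on $L$: $L$ is a closed linear operator on $H$ generating a strongly continuous semigroup $(e^{tL})_{t\ge0}$ which is exponentially stable. Its spectrum satisfies $\Re\,\mathrm{spec}(L)<0$ and $\mathrm{spec}(L)=\mathrm{spec}_{\rm ess}(L)\cup\{\lambda_j\}_{1\le j\le n}$, where $n$ is finite, the $\lambda_j$ are isolated eigenvalues of finite multiplicity (counted with multiplicity, ordered so that $\Re\lambda_i\le\Re\lambda_j$ for $i<j$), and every point of the essential spectrum $\mathrm{spec}_{\rm ess}(L)$ (which may be empty) has real part strictly smaller than $\Re\lambda_j$ for all $j$. The restriction of $L$ to the space associated with the eigenvalues $\lambda_j$ is diagonalizable (no nontrivial Jordan blocks), and $\hat{x}_1,\dots,\hat{x}_n$ are corresponding linearly independent eigenvectors, $L\hat{x}_j=\lambda_j\hat{x}_j$ (the ''slow modes''). Since $\Re\,\mathrm{spec}(L)<0$, the number $-\lambda_j^*$ lies in the resolvent set of $L$, so $(L+\lambda_j^* )^{-1}$ is a bounded operator on $H$. Under these assumptions the matrix $G$ is invertible, so $\mathbb{P}_{\rm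 DOP}$ (the ''dynamically optimal projection'') is well defined. *)

(* Defs.v *)
From HB Require Import structures.
From mathcomp Require Import all_boot all_order all_algebra.
From mathcomp Require Import complex.
From mathcomp Require Import all_classical all_reals all_analysis.

Set Implicit Arguments.
Unset Strict Implicit.
Unset Printing Implicit Defensive.
Import Order.TTheory GRing.Theory Num.Theory.
Import numFieldNormedType.Exports.
Local Open Scope classical_set_scope.
Local Open Scope ring_scope.
Local Open Scope complex_scope.

(* A complex Hilbert space is a complete normed space H over R[i] together with
   ip : {dot H for Num.Def.conjC} (linear in the first argument,
   conjugate-linear in the second) that induces the norm. *)
Definition induces_norm (R : realType) (H : completeNormedModType R[i])
    (ip : {dot H for @Num.Def.conjC R[i]}) : Prop :=
  forall x : H, `|x| ^+ 2 = ip x x.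

Definition lin_indep (K : nzRingType) (V : lmodType K) (n : nat)
    (v : 'I_n -> V) : Prop :=
  forall c : 'I_n -> K, \sum_i c i *: v i = 0 -> forall i, c i = 0.

Definition lspan (K : nzRingType) (V : lmodType K) (n : nat)
    (v : 'I_n -> V) : set V :=
  [set x | exists c : 'I_n -> K, x = \sum_i c i *: v i].

Definition has_dim (K : nzRingType) (V : lmodType K) (E : set V) (n : nat)
    : Prop :=
  exists v : 'I_n -> V, lin_indep v /\ lspan v = E.

Definition orthogonal_projection_onto (R : realType)
    (H : completeNormedModType R[i]) (ip : {dot H for @Num.Def.conjC R[i]})
    (E : set H) (P : H -> H) : Prop :=
  [/\ linear P,
      forall x, P (P x) = P x,
      range P = E
    & forall x s, P x = 0 -> E s -> ip x s = 0].

(* The values of the underlying function outside the domain are junk and no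
   definition below depends on them. *)
Record linop (R : realType) (H : completeNormedModType R[i]) := Linop {
  dom : set H;
  linop_fun :> H -> H;
  dom0 : dom 0;
  dom_linear : forall a x y, dom x -> dom y -> dom (a *: x + y);
  linop_linear : forall a x y, dom x -> dom y ->
    linop_fun (a *: x + y) = a *: linop_fun x + linop_fun y }.

Definition graph (R : realType) (H : completeNormedModType R[i])
    (L : linop H) : set (H * H) :=
  [set p | dom L p.1 /\ L p.1 = p.2].

Definition closed_operator (R : realType) (H : completeNormedModType R[i])
    (L : linop H) : Prop := closed (graph L).

(* The adjoint is kept as a relation: (y, z) is in the graph of the adjoint iff
   <L x, y> = <x, z> for all x in the domain of L.  It is functional
   when L is densely defined, as semigroup generators are. *)
Definition adjoint_graph (R : realType) (H : completeNormedModType R[i])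
    (ip : {dot H for @Num.Def.conjC R[i]}) (L : linop H) : set (H * H) :=
  [set p | forall x, dom L x -> ip (L x) p.1 = ip x p.2].

(* Equality of graphs is equality of operators including their domains;
   (B \; A)%relation is the composition "first A, then B". *)
Definition normal_operator (R : realType) (H : completeNormedModType R[i])
    (ip : {dot H for @Num.Def.conjC R[i]}) (L : linop H) : Prop :=
  (graph L \; adjoint_graph ip L)%relation =
  (adjoint_graph ip L \; graph L)%relation.

(* (L + mu)^-1 x, equal to 0 when x is not in the range of L + mu. *)
Definition inv_shift (R : realType) (H : completeNormedModType R[i])
    (L : linop H) (mu : R[i]) (x : H) : H :=
  xget 0 [set y | dom L y /\ L y + mu *: y = x].

(* Only the values T t for 0 <= t matter. *)
Definition C0_semigroup (R : realType) (H : completeNormedModType R[i])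
    (T : R -> {linear H -> H}) : Prop :=
  [/\ forall t, 0 <= t -> continuous (T t),
      forall x, T 0 x = x,
      forall s t x, 0 <= s -> 0 <= t -> T (s + t) x = T s (T t x)
    & forall x, T t x @[t --> 0^'+] --> x].

Definition generator (R : realType) (H : completeNormedModType R[i])
    (L : linop H) (T : R -> {linear H -> H}) : Prop :=
  graph L = [set p | (h^-1)%:C *: (T h p.1 - p.1) @[h --> 0^'+] --> p.2].

Definition exponentially_stable (R : realType)
    (H : completeNormedModType R[i]) (T : R -> {linear H -> H}) : Prop :=
  exists M omega : R, 0 < omega /\
    forall t x, 0 <= t -> `|T t x| <= (M * expR (- omega * t))%:C * `|x|.

Definition resolvent_set (R : realType) (H : completeNormedModType R[i])
    (L : linop H) : set R[i] :=
  [set z | exists B : {linear H -> H},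
    [/\ continuous B,
        forall x, dom L (B x) /\ L (B x) - z *: B x = x
      & forall y, dom L y -> B (L y - z *: y) = y]].

Definition spectrum (R : realType) (H : completeNormedModType R[i])
    (L : linop H) : set R[i] := ~` resolvent_set L.

Definition eigenvector (R : realType) (H : completeNormedModType R[i])
    (L : linop H) (z : R[i]) (v : H) : Prop :=
  [/\ v != 0, dom L v & L v = z *: v].

Definition cintegral (R : realType) (a b : R) (f : R -> R[i]) : R[i] :=
  (Rintegral lebesgue_measure `[a, b] (fun t => complex.Re (f t)))
  +i* (Rintegral lebesgue_measure `[a, b] (fun t => complex.Im (f t))).

Definition circle (R : realType) (r t : R) : R[i] :=
  r%:C * (cos t +i* sin t).

(* P = (2 pi i)^-1 \oint (w - L)^-1 dw over the circle w = z + r e^{it}, as a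
   weak integral; dw = i r e^{it} dt and (w - L)^-1 = - (L - w)^-1.  The circle
   encloses no point of the spectrum of L other than z. *)
Definition riesz_projection (R : realType) (H : completeNormedModType R[i])
    (ip : {dot H for @Num.Def.conjC R[i]}) (L : linop H) (z : R[i])
    (P : {linear H -> H}) : Prop :=
  exists r : R,
    [/\ 0 < r,
        forall w, spectrum L w -> `|w - z| <= r%:C -> w = z
      & forall x y, ip (P x) y =
          ((2 * pi)^-1)%:C * cintegral 0 (2 * pi) (fun t =>
            ip (- inv_shift L (- (z + circle r t)) x) y * circle r t)].

(* The range of the Riesz projection; its dimension is the (algebraic)
   multiplicity of z.  The existential is harmless, since the projection is
   unique and does not depend on the radius. *)
Definition spectral_space (R : realType) (H : completeNormedModType R[i])
    (ip : {dot H for @Num.Def.conjC R[i]}) (L : linop H) (z : R[i]) : set H :=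
  [set v | exists2 P : {linear H -> H},
             riesz_projection ip L z P & range P v].

Definition isolated_in (R : realType) (S : set R[i]) (z : R[i]) : Prop :=
  S z /\ exists r : R, 0 < r /\ forall w, S w -> `|w - z| < r%:C -> w = z.

Definition discrete_spectrum (R : realType) (H : completeNormedModType R[i])
    (ip : {dot H for @Num.Def.conjC R[i]}) (L : linop H) : set R[i] :=
  [set z | [/\ isolated_in (spectrum L) z,
               exists v, eigenvector L z v
             & exists m, has_dim (spectral_space ip L z) m]].

(* Browder's essential spectrum, the largest of the usual ones; for an operator
   whose spectrum is the union of its (Fredholm or Weyl) essential spectrum and
   a finite part of its discrete spectrum all of them coincide. *)
Definition essential_spectrum (R : realType) (H : completeNormedModType R[i])
    (ip : {dot H for @Num.Def.conjC R[i]}) (L : linop H) : set R[i] :=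
  spectrum L `\` discrete_spectrum ip L.

Definition simple_eigenvalue (R : realType) (H : completeNormedModType R[i])
    (ip : {dot H for @Num.Def.conjC R[i]}) (L : linop H) (z : R[i]) : Prop :=
  (exists v, eigenvector L z v) /\ has_dim (spectral_space ip L z) 1.

Definition spectral_sum (R : realType) (H : completeNormedModType R[i])
    (ip : {dot H for @Num.Def.conjC R[i]}) (L : linop H) (n : nat)
    (lam : 'I_n -> R[i]) : set H :=
  [set x | exists v : 'I_n -> H,
    (forall j, spectral_space ip L (lam j) (v j)) /\ x = \sum_j v j].

Definition diagonalizable_on (R : realType) (H : completeNormedModType R[i])
    (L : linop H) (E : set H) : Prop :=
  exists (m : nat) (mu : 'I_m -> R[i]) (v : 'I_m -> H),
    [/\ lin_indep v, lspan v = E & forall k, eigenvector L (mu k) (v k)].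

Record standing_assumptions (R : realType) (H : completeNormedModType R[i])
    (ip : {dot H for @Num.Def.conjC R[i]}) (L : linop H) (n : nat)
    (lam : 'I_n -> R[i]) (xhat : 'I_n -> H) : Prop := StandingAssumptions {
  sa_closed : closed_operator L;
  sa_semigroup : exists T : R -> {linear H -> H},
    [/\ C0_semigroup T, generator L T & exponentially_stable T];
  sa_stable : forall z, spectrum L z -> complex.Re z < 0;
  sa_spectrum : spectrum L = essential_spectrum ip L `|` range lam;
  sa_discrete : forall j, discrete_spectrum ip L (lam j);
  (* each eigenvalue is listed as often as its multiplicity *)
  sa_multiplicity : forall j,
    has_dim (spectral_space ip L (lam j)) #|[pred i | lam i == lam j]|;
  sa_ordered : forall i j : 'I_n,
    (i < j)%N -> complex.Re (lam i) <= complex.Re (lam j);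
  sa_gap : forall z j,
    essential_spectrum ip L z -> complex.Re z < complex.Re (lam j);
  sa_diagonalizable : diagonalizable_on L (spectral_sum ip L lam);
  sa_indep : lin_indep xhat;
  sa_eigenvector : forall j, eigenvector L (lam j) (xhat j) }.

Definition Gmx (R : realType) (H : completeNormedModType R[i])
    (ip : {dot H for @Num.Def.conjC R[i]}) (n : nat)
    (lam : 'I_n -> R[i]) (xhat : 'I_n -> H) : 'M[R[i]]_n :=
  \matrix_(i, j) (ip (xhat i) (xhat j) / (lam i + (lam j)^*)).

Definition P_DOP (R : realType) (H : completeNormedModType R[i])
    (ip : {dot H for @Num.Def.conjC R[i]}) (L : linop H) (n : nat)
    (lam : 'I_n -> R[i]) (xhat : 'I_n -> H) (x : H) : H :=
  \sum_i \sum_j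
    (invmx (Gmx ip lam xhat)^T i j * ip (inv_shift L (lam j)^* x) (xhat j))
      *: xhat i.

(* Main.v *)
Require Import Defs.
From HB Require Import structures.
From mathcomp Require Import all_boot all_order all_algebra.
From mathcomp Require Import complex.
From mathcomp Require Import all_classical all_reals all_analysis.
From mathcomp Require Import ring lra.
Import Order.TTheory GRing.Theory Num.Theory.
Import numFieldNormedType.Exports.
Local Open Scope classical_set_scope.
Local Open Scope ring_scope.
Local Open Scope complex_scope.

(** A normal [L] satisfies [L^dagger x_j = lam_j^* x_j] on its eigenvectors.
    Since [0] lies in the resolvent set, this can be read off the bounded inverse
    [B = L^-1]: equality of the graphs of [L L^dagger] and [L^dagger L] makes
    [w = B^dagger x_j] (which exists by Riesz representation) an eigenvector of [B]
    for the same eigenvalue as [x_j], and expanding [|w - lam_j^{-*} x_j|^2] gives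
    [w = lam_j^{-*} x_j].
    Hence [<(L + lam_j^* )^-1 x, x_j> = <x, x_j> / (lam_j + lam_j^* )], and
    eigenvectors for distinct eigenvalues are orthogonal, so that
    [G_ij = <x_i, x_j> / (lam_j + lam_j^* )].  The factors [lam_j + lam_j^*] then
    cancel in the definition of [P_DOP], which amounts to solving
    [<P x, x_j> = <x, x_j>] for [P x] in the span of the [x_j]. *)

Set Implicit Arguments.
Unset Strict Implicit.

(** * Inner product, Cauchy-Schwarz inequality and Riesz representation *)

Section InnerProduct.
Variables (R : realType) (H : completeNormedModType R[i])
    (ip : {dot H for @Num.Def.conjC R[i]}).

Lemma ipC u v : ip u v = conjc (ip v u).
Proof. by rewrite hermC expr0 mul1r. Qed.

Lemma ipZr (a : R[i]) u v : ip u (a *: v) = conjc a * ip u v.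
Proof. by rewrite linearZr_LR. Qed.

Lemma ipZl (a : R[i]) u v : ip (a *: u) v = a * ip u v.
Proof. by rewrite linearZl_LR. Qed.

Lemma ipDl u v w : ip (u + v) w = ip u w + ip v w.
Proof. by rewrite linearDl. Qed.

Lemma ipBl u v w : ip (u - v) w = ip u w - ip v w.
Proof. by rewrite linearBl. Qed.

Lemma ipBr u v w : ip w (u - v) = ip w u - ip w v.
Proof. by rewrite linearBr. Qed.

Lemma ip_suml (n : nat) (c : 'I_n -> R[i]) (v : 'I_n -> H) w :
  ip (\sum_i c i *: v i) w = \sum_i c i * ip (v i) w.
Proof. by rewrite linear_sumlz; apply: eq_bigr => i _; rewrite -ipZl. Qed.

Lemma ip_eq0 u : ip u u = 0 -> u = 0.
Proof. by move/eqP; rewrite dnorm_eq0 => /eqP. Qed.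

(** Squared distance from [u] to the line through [y]: its nonnegativity yields Cauchy-Schwarz, and
    its comparison with [ip u u] yields the orthogonality of the minimiser in Riesz
    representation. *)
Lemma dnorm_sub_proj u y : ip y y != 0 ->
  let z := u - (ip u y / ip y y) *: y in
  ip z z = ip u u - `|ip u y| ^+ 2 / ip y y.
Proof.
move=> y0 /=; rewrite dnormB -[Num.conj]/(@conjc R) ipZl !ipZr !rmorphM /=.
rewrite sqr_normc !conjc_inv !conjcK -!(ipC y y).
set c := ip u y; set p := ip y y.
by field.
Qed.

Hypothesis hip : induces_norm ip.

(** Norms live in [R[i]], which is only partially ordered; the real copy [g] gives access to infima,
    square roots and [lra]. *)
Let g (x : H) : R := complex.Re `|x|.

Let gE x : `|x| = (g x)%:C.
Proof. by rewrite RRe_real // normr_real. Qed.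

Let g_ge0 x : 0 <= g x.
Proof. by rewrite -ler0c -gE. Qed.

Let gD x y : g (x + y) <= g x + g y.
Proof. by rewrite -lecR rmorphD /= -!gE ler_normD. Qed.

Let gsq x : ip x x = (g x ^+ 2)%:C.
Proof. by rewrite -hip gE -(rmorphXn (real_complex R)). Qed.

(** Parallelogram law, solved for the difference so as to make minimising sequences Cauchy. *)
Let gpar x y : g (x - y) ^+ 2 = 2 * g x ^+ 2 + 2 * g y ^+ 2 - g (x + y) ^+ 2.
Proof.
have /(congr1 (@complex.Re R)) := dnormB ip x y.
have /(congr1 (@complex.Re R)) := dnormD ip x y.
by rewrite !gsq; case: (ip x y) => a b /= -> ->; ring.
Qed.

Let gZ (a : R) x : 0 <= a -> g (a%:C *: x) = a * g x.
Proof.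
move=> a0; apply: (@complexI R); rewrite rmorphM /= -!gE normrZ.
by rewrite ger0_norm // ler0c.
Qed.

Lemma ip_le_norm u v : `|ip u v| <= `|u| * `|v|.
Proof.
have [->|v0] := eqVneq v 0; first by rewrite linear0r !normr0 mulr0.
have vv : 0 < ip v v by rewrite -hip exprn_gt0 // normr_gt0.
have : 0 <= ip u u - `|ip u v| ^+ 2 / ip v v.
  by rewrite -dnorm_sub_proj ?gt_eqF // gsq ler0c sqr_ge0.
rewrite subr_ge0 ler_pdivrMr // -!hip -exprMn.
by rewrite ler_pXn2r ?nnegrE ?mulr_ge0.
Qed.

Lemma ip_continuous v : continuous (ip^~ v : H -> R[i]^o).
Proof.
move=> x; apply/cvgrPdist_lt => e e0.
(* The summand 1 keeps the divisor positive when [v = 0]. *)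
have v1 : 0 < 1 + `|v| by rewrite ltr_pwDl.
have d0 : 0 < e / (1 + `|v|) by rewrite divr_gt0.
have := nbhsx_ballx x _ d0; rewrite -ball_normE; apply: filterS => y /=.
rewrite ltr_pdivlMr // => xy; rewrite -ipBl.
apply: le_lt_trans (ip_le_norm _ _) (le_lt_trans _ xy).
by rewrite ler_wpM2l // lerDr.
Qed.

(* The representing vector is a multiple of the element of least norm in the
   hyperplane [f = 1], obtained as the limit of a minimising sequence. *)
Lemma riesz_representation (f : {linear H -> R[i]^o}) :
  continuous f -> exists w, forall x, f x = ip x w.
Proof.
move=> fc.
(* By scaling, a functional that never takes the value 1 is zero. *)
have [[x0 fx0]|f0] := pselect (exists x, f x = 1); last first.
  exists 0 => x; rewrite linear0r; apply: contrapT => fx; apply: f0.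
  exists ((f x)^-1 *: x); rewrite linearZ /= /GRing.scale /= mulVf //.
  exact/eqP.
pose E := [set g x ^+ 2 | x in [set x | f x = 1]].
have E0 : E !=set0 by exists (g x0 ^+ 2), x0.
have Elb : has_lbound E by exists 0 => _ [x _ <-]; exact: sqr_ge0.
pose D := inf E.
have DE x : f x = 1 -> D <= g x ^+ 2.
  by move=> fx; apply: ge_inf => //=; exists x.
have D0 : 0 <= D by apply: lb_le_inf => // _ [x _ <-]; exact: sqr_ge0.
(* The midpoint of [x] and [y] stays in the hyperplane. *)
have D4 x y : f x = 1 -> f y = 1 -> 4 * D <= g (x + y) ^+ 2.
  move=> fx fy; have := DE ((2^-1 : R)%:C *: (x + y)).
  rewrite gZ ?invr_ge0 //; set q := g (x + y).
  have -> : f ((2^-1 : R)%:C *: (x + y)) = 1.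
    rewrite linearZ linearD /= fx fy /GRing.scale /= -mulr2n -mulr_natl mulr1.
    by rewrite -(rmorph_nat (real_complex R)) -rmorphM mulVf.
  by move=> /(_ erefl); rewrite exprMn; lra.
have /choice [x_ x_P] (n : nat) : exists x, f x = 1 /\ g x ^+ 2 < D + n.+1%:R^-1.
  have n0 : 0 < n.+1%:R^-1 :> R by rewrite invr_gt0.
  by have [_ [x fx <-] xD] := inf_adherent n0 (conj E0 Elb); exists x.
(* The terms in [D] cancel: [2 (D + a) + 2 (D + b) - 4 D] is at most [4 a] when [b <= a]. *)
have close n m : (n <= m)%N -> g (x_ n - x_ m) ^+ 2 < 4 * n.+1%:R^-1.
  move=> nm; rewrite gpar; have [fn Hn] := x_P n; have [fm Hm] := x_P m.
  have := D4 _ _ fn fm.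
  have : m.+1%:R^-1 <= n.+1%:R^-1 :> R by rewrite lef_pV2 ?posrE ?ler_nat.
  by move: Hn Hm; move: n.+1%:R^-1 m.+1%:R^-1 => a b; lra.
have small (e : R) : 0 < e -> exists n : nat, n.+1%:R^-1 < e.
  move=> e0; exists (Num.trunc e^-1).
  by rewrite invf_plt ?posrE // truncnS_gt.
have : cvg (x_ @ \oo).
  apply/cauchy_cvgP/cauchy_exP => e e0.
  have er : e = (complex.Re e)%:C by rewrite RRe_real // gtr0_real.
  have re0 : 0 < complex.Re e by rewrite -ltcR -er.
  have e4 : 0 < complex.Re e ^+ 2 / 4 by rewrite divr_gt0 // exprn_gt0.
  have [n nP] := small _ e4.
  exists (x_ n); exists n => // m /= nm.
  rewrite -ball_normE /ball_ /= gE er ltcR -(@ltr_pXn2r _ 2) ?nnegrE ?(ltW re0) //.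
  by apply: lt_trans (close _ _ nm) _; move: nP; move: n.+1%:R^-1 => a; lra.
move=> /cvg_ex [u xu].
have fu : f u = 1.
  have h1 : f (x_ n) @[n --> \oo] --> f u.
    by apply: cvg_comp xu (fc u).
  have h2 : f (x_ n) @[n --> \oo] --> (1 : R[i]^o).
    by rewrite (_ : (fun n => f (x_ n)) = fun=> 1); [exact: cvg_cst|
      apply/funext => n; case: (x_P n)].
  exact: cvg_unique h1 h2.
(* Otherwise take [b] halfway between [sqrt D] and [g u]: for large [n], [g (x_ n) < b] and
   [g (u - x_ n) < g u - b] contradict the triangle inequality. *)
have gu : g u ^+ 2 <= D.
  rewrite leNgt; apply/negP => Du.
  pose s := Num.sqrt D.
  have s0 : 0 <= s by exact: sqrtr_ge0.
  have sD : s ^+ 2 = D by exact: sqr_sqrtr.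
  have su : s < g u by rewrite -(@ltr_pXn2r _ 2) ?nnegrE // sD.
  pose b := (s + g u) / 2.
  have bD : D < b ^+ 2 by rewrite -sD ltr_pXn2r ?nnegrE // /b; lra.
  have b0 : 0 < b ^+ 2 - D by rewrite subr_gt0.
  have [n1 n1P] := small _ b0.
  have e0 : 0 < (g u - b)%:C by rewrite ltcR /b; lra.
  have /cvgrPdist_lt /(_ _ e0) [n2 _ n2P] := xu.
  pose n := maxn n1 n2.
  have : g (u - x_ n) < g u - b by rewrite -ltcR -gE; apply: n2P; exact: leq_maxr.
  have xb : g (x_ n) < b.
    rewrite -(@ltr_pXn2r _ 2) ?nnegrE //; last by rewrite /b; lra.
    have [_ xn] := x_P n.
    have : n.+1%:R^-1 <= n1.+1%:R^-1 :> R.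
      by rewrite lef_pV2 ?posrE ?ler_nat // ltnS leq_maxl.
    by move: xn n1P; move: n.+1%:R^-1 n1.+1%:R^-1 => c d; lra.
  by have := gD (u - x_ n) (x_ n); rewrite subrK; lra.
(* Removing from [u] its component along [y] stays in the hyperplane and would shorten [u] if
   [ip u y] were nonzero. *)
have orth y : f y = 0 -> ip u y = 0.
  move=> fy; apply/eqP/contraT => uy.
  have y0 : ip y y != 0.
    by apply: contra uy => /eqP/ip_eq0 ->; rewrite linear0r.
  have : ip u u <= ip u u - `|ip u y| ^+ 2 / ip y y.
    rewrite -dnorm_sub_proj // !gsq lecR; apply: (le_trans gu); apply: DE.
    by rewrite linearB linearZ /= fu fy /GRing.scale /= mulr0 subr0.
  rewrite lerDl oppr_ge0 lt_geF // divr_gt0 ?exprn_gt0 ?normr_gt0 //.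
  by rewrite lt_def y0 gsq ler0c sqr_ge0.
have u0 : ip u u != 0.
  apply/eqP => /ip_eq0 uz; move: fu; rewrite uz linear0 => /eqP.
  by rewrite eq_sym oner_eq0.
have uc : conjc (ip u u) = ip u u by rewrite -ipC.
(* Since [x - f x *: u] lies in the kernel of [f], it is orthogonal to [u], so
   [ip x u = f x * ip u u]. *)
exists ((ip u u)^-1 *: u) => x; rewrite ipZr conjc_inv uc.
pose a : R[i] := f x.
have : ip u (x - a *: u) = 0.
  by apply: orth; rewrite linearB linearZ /= fu /GRing.scale /= mulr1 subrr.
move=> /(congr1 (@conjc R)); rewrite -ipC conjc0 ipBl ipZl => /eqP.
by rewrite subr_eq0 => /eqP ->; rewrite mulrCA mulVf ?mulr1.
Qed.
End InnerProduct.

(** * Eigenvectors of a normal operator, and its shifted inverse *)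

Section Operator.
Variables (R : realType) (H : completeNormedModType R[i])
    (ip : {dot H for @Num.Def.conjC R[i]}).

Hypothesis hip : induces_norm ip.

Lemma adjoint_exists (B : {linear H -> H}) v :
  continuous B -> exists w, forall x, ip (B x) v = ip x w.
Proof.
move=> Bc.
have lf : linear (fun x => ip (B x) v : R[i]^o).
  by move=> a x y; rewrite linearP ipDl ipZl.
pose f : {linear H -> R[i]^o} :=
  HB.pack (fun x => ip (B x) v : R[i]^o) (GRing.isLinear.Build _ _ _ _ _ lf).
have [|w fw] := riesz_representation hip (f := f); last by exists w.
by move=> x; exact: (cvg_comp _ _ (Bc x) (ip_continuous hip (v:=v) (x:=B x))).
Qed.

Lemma ip_inj x y : (forall u, ip u x = ip u y) -> x = y.
Proof.
move=> e; apply/eqP; rewrite -subr_eq0.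
by apply/eqP/(@ip_eq0 _ _ ip); rewrite ipBr e subrr.
Qed.

Lemma normal_eigenvector_adjoint (L : linop H) (z : R[i]) (v : H) :
  normal_operator ip L -> resolvent_set L 0 -> z != 0 -> eigenvector L z v ->
  forall x, dom L x -> ip (L x) v = z * ip x v.
Proof.
move=> nL [B [Bc LB BL]] z0 [v0 dv Lv].
have {}LB x : dom L (B x) /\ L (B x) = x.
  by have := LB x; rewrite scale0r subr0.
have {}BL y : dom L y -> B (L y) = y.
  by move=> /BL; rewrite scale0r subr0.
have Bv : B v = z^-1 *: v.
  by rewrite -{2}(BL v) // Lv linearZ scalerA mulVf // scale1r.
have [w wP] := adjoint_exists v Bc.
have : (adjoint_graph ip L \; graph L)%relation (B w, v).
  exists w; first exact: LB.
  by move=> x dx /=; rewrite -wP BL.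
(* Here [B w] is sent to [w] by [L] and then to [v] by the adjoint. In the other order the
   intermediate point [y] satisfies [L y = v], hence [y = B v]. *)
rewrite -nL => -[y /= adj [/= dy Ly]].
have {adj dy Ly} adj x : dom L x -> ip (L x) (B w) = ip x (z^-1 *: v).
  by move=> dx; rewrite adj // -Bv -Ly BL.
have Bw : B w = z^-1 *: w.
  apply: ip_inj => u; have [du Lu] := LB u.
  by rewrite -{1}Lu adj // !ipZr wP.
(* Evaluating [wP] at [w] and at [v] makes the four terms of the expanded square cancel in pairs. *)
have ww : ip w w = z^-1 * ip w v by rewrite -wP Bw ipZl.
have vw : ip v w = z^-1 * ip v v by rewrite -wP Bv ipZl.
have w_v : w = conjc z^-1 *: v.
  apply/eqP; rewrite -subr_eq0; apply/eqP/(@ip_eq0 _ _ ip).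
  rewrite !(ipBl, ipBr) !(ipZl, ipZr) conjcK ww vw.
  by ring.
move=> x dx; rewrite -{2}(BL x) // wP w_v ipZr conjcK mulrA mulfV ?mul1r //.
Qed.

(** The resolvent supplies a preimage of every [x], so [xget] never falls back on its default. *)
Lemma inv_shift_resolvent (L : linop H) (mu : R[i]) : resolvent_set L (- mu) ->
  forall x, dom L (inv_shift L mu x) /\
    L (inv_shift L mu x) + mu *: inv_shift L mu x = x.
Proof.
move=> [B [_ LB _]] x; rewrite /inv_shift.
by case: xgetP => [y -> //|/(_ (B x)) []]; have [d] := LB x; rewrite scaleNr opprK.
Qed.

End Operator.

(** * Spans and uniqueness of dimension *)

Lemma lspan_linear (K : nzRingType) (V : lmodType K) (n : nat) (v : 'I_n -> V)
    (a : K) (x y : V) : lspan v x -> lspan v y -> lspan v (a *: x + y).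
Proof.
move=> [c ->] [d ->]; exists (fun i => a * c i + d i).
rewrite scaler_sumr -big_split /=; apply: eq_bigr => i _.
by rewrite scalerDl scalerA.
Qed.

Lemma lspan_gen (K : nzRingType) (V : lmodType K) (n : nat) (v : 'I_n -> V) i :
  lspan v (v i).
Proof.
exists (fun j => (j == i)%:R); rewrite (bigD1 i) //= eqxx scale1r big1 ?addr0 //.
by move=> j /negbTE ->; rewrite scale0r.
Qed.

(** The coordinates of the [v i] in terms of [w] form an [n] by [m] matrix with independent rows,
    whose rank is at most [m]. *)
Lemma lin_indep_leq (K : fieldType) (V : lmodType K) (n m : nat)
    (v : 'I_n -> V) (w : 'I_m -> V) :
  lin_indep v -> lspan v `<=` lspan w -> (n <= m)%N.
Proof.
move=> vi vw.
have /choice [A AP] i : exists c : 'I_m -> K, v i = \sum_j c j *: w j.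
  exact: vw (lspan_gen v i).
pose M := \matrix_(i, j) A i j.
suff /eqP <- : row_free M by exact: rank_leq_col.
apply: inj_row_free => u uM; apply/rowP => i; rewrite mxE.
apply: (vi (fun i => u 0 i)).
under eq_bigr => j _ do rewrite AP scaler_sumr.
rewrite exchange_big big1 //= => k _.
under eq_bigr => j _ do rewrite scalerA.
rewrite -scaler_suml; have /rowP /(_ k) := uM.
rewrite !mxE; under eq_bigr do rewrite mxE.
by move=> ->; rewrite scale0r.
Qed.

Lemma has_dim_uniq (K : fieldType) (V : lmodType K) (E : set V) (n m : nat) :
  has_dim E n -> has_dim E m -> n = m.
Proof.
move=> [v [vi vE]] [w [wi wE]]; apply/eqP; rewrite eqn_leq.
by rewrite (lin_indep_leq (w := w) vi) ?(lin_indep_leq (w := v) wi) ?vE ?wE.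
Qed.

(** * Projection onto a span, characterised by inner products with the generators *)

Section Projection.
Variables (R : realType) (H : completeNormedModType R[i])
    (ip : {dot H for @Num.Def.conjC R[i]}) (n : nat) (x_ : 'I_n -> H).

Lemma lspan_orth_eq0 y : lspan x_ y -> (forall k, ip y (x_ k) = 0) -> y = 0.
Proof.
move=> [c yE] yo; apply/(@ip_eq0 _ _ ip).
by rewrite {1}yE ip_suml big1 // => i _; rewrite ipC yo conjc0 mulr0.
Qed.

Lemma lspan_orth y s : (forall k, ip y (x_ k) = 0) -> lspan x_ s -> ip y s = 0.
Proof.
move=> yo [c ->]; rewrite ipC ip_suml big1 ?conjc0 // => i _.
by rewrite ipC yo conjc0 mulr0.
Qed.

Lemma lspan_ip_eq y z : lspan x_ y -> lspan x_ z ->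
  (forall k, ip y (x_ k) = ip z (x_ k)) -> y = z.
Proof.
move=> sy sz e; apply/esym/eqP; rewrite -subr_eq0 addrC -scaleN1r.
by apply/eqP/lspan_orth_eq0 => [|k];
  [exact: lspan_linear|rewrite ipDl ipZl mulN1r e addNr].
Qed.

Lemma orthogonal_projection_lspan (P : H -> H) :
  (forall x, lspan x_ (P x)) -> (forall x k, ip (P x) (x_ k) = ip x (x_ k)) ->
  orthogonal_projection_onto ip (lspan x_) P.
Proof.
move=> sP iP.
have Pid x : lspan x_ x -> P x = x by move=> sx; apply: lspan_ip_eq.
split.
- move=> a x y; apply: lspan_ip_eq => // [|k]; first exact: lspan_linear.
  by rewrite iP !ipDl !ipZl !iP.
- by move=> x; apply: Pid.
- by apply/seteqP; split => [_ [x _ <-] //|x sx]; exists x => //; exact: Pid.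
- move=> x s Px0; apply: lspan_orth => k.
  by rewrite -iP Px0 linear0l.
Qed.

Lemma P_DOP_lspan (L : linop H) (lam : 'I_n -> R[i]) x :
  lspan x_ (P_DOP ip L lam x_ x).
Proof.
exists (fun i => \sum_j invmx (Gmx ip lam x_)^T i j *
  ip (inv_shift L (conjc (lam j)) x) (x_ j)).
by apply: eq_bigr => i _; rewrite scaler_suml.
Qed.

(** The hypothesis on [Gmx] makes it the Gram matrix with column [j] divided by [s j]; it is
    invertible because the [x_ i] are independent. *)
Lemma P_DOP_ip (L : linop H) (lam s : 'I_n -> R[i]) x :
  lin_indep x_ -> (forall k, s k != 0) ->
  (forall i j, Gmx ip lam x_ i j = ip (x_ i) (x_ j) / s j) ->
  (forall j, ip x (x_ j) = s j * ip (inv_shift L (conjc (lam j)) x) (x_ j)) ->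
  forall k, ip (P_DOP ip L lam x_ x) (x_ k) = ip x (x_ k).
Proof.
move=> xi s0 + dE k; rewrite /P_DOP; move: (Gmx ip lam x_) => G GE.
have Gu : G \in unitmx.
  rewrite -row_free_unit; apply: inj_row_free => u uG; apply/rowP => i; rewrite mxE.
  (* A left kernel vector of [G] gives a combination of the [x_ i] orthogonal to all of them. *)
  apply: (xi (fun i => u 0 i)); apply: lspan_orth_eq0 => [|j]; first by eexists.
  have /rowP /(_ j) := uG; rewrite !mxE ip_suml.
  under eq_bigr do rewrite GE mulrA.
  by move/eqP; rewrite -mulr_suml mulf_eq0 invr_eq0 (negbTE (s0 j)) orbF => /eqP.
pose d := \col_j ip (inv_shift L (conjc (lam j)) x) (x_ j).
pose c := invmx G^T *m d.
have Gc : G^T *m c = d by rewrite mulmxA mulmxV ?unitmx_tr // mul1mx.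
have -> : \sum_i \sum_j (invmx G^T i j *
    ip (inv_shift L (conjc (lam j)) x) (x_ j)) *: x_ i = \sum_i c i 0 *: x_ i.
  apply: eq_bigr => i _; rewrite !mxE scaler_suml.
  by apply: eq_bigr => j _; rewrite mxE.
(* Row [k] of [G^T c = d], multiplied by [s k], is the claim. *)
rewrite ip_suml dE; have /colP /(_ k) := Gc; rewrite 2!mxE => <-.
rewrite mulr_sumr; apply: eq_bigr => i _.
by rewrite [G^T k i]mxE GE; move: (c i 0) (s k) (s0 k) => a b b0; field.
Qed.

End Projection.

(** Evaluating [ip (L v) w] on either side gives [z * ip v w = z' * ip v w]. *)
Lemma normal_eigenvectors_orthogonal (R : realType) (H : completeNormedModType R[i])
    (ip : {dot H for @Num.Def.conjC R[i]}) (L : linop H) (z z' : R[i]) (v w : H) :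
  induces_norm ip -> normal_operator ip L -> resolvent_set L 0 ->
  z' != 0 -> eigenvector L z v -> eigenvector L z' w -> z != z' -> ip v w = 0.
Proof.
move=> hip nL r0 z'0 [_ dv Lv] ew zz'.
have := normal_eigenvector_adjoint hip nL r0 z'0 ew dv.
rewrite Lv ipZl => /eqP; rewrite -subr_eq0 -mulrBl mulf_eq0 subr_eq0 (negbTE zz').
by move/eqP.
Qed.

Unset Implicit Arguments.
Set Strict Implicit.

Theorem mainTheorem3 (R : realType) (H : completeNormedModType R[i])
    (ip : {dot H for @Num.Def.conjC R[i]}) (L : linop H) (n : nat)
    (lam : 'I_n -> R[i]) (xhat : 'I_n -> H) :
  induces_norm ip ->
  standing_assumptions ip L lam xhat ->
  normal_operator ip L ->
  orthogonal_projection_onto ip (lspan xhat) (P_DOP ip L lam xhat) /\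
  ((forall j, simple_eigenvalue ip L (lam j)) ->
   (forall j, `|xhat j| = 1) ->
   (forall i j, Gmx ip lam xhat i j =
      ((2 * complex.Re (lam i))^-1)%:C * (i == j)%:R) /\
   (forall x : H, P_DOP ip L lam xhat x = \sum_j ip x (xhat j) *: xhat j)).
Proof.
move=> hip sa nL.
have stable := sa_stable sa; have ev := sa_eigenvector sa.
have res z : 0 <= complex.Re z -> resolvent_set L z.
  by move=> z0; apply: contrapT => /stable; rewrite ltNge z0.
have lam_lt0 j : complex.Re (lam j) < 0.
  by apply: stable; have [[]] := sa_discrete sa j.
have lam0 j : lam j != 0.
  by apply: contraTneq (lam_lt0 j) => ->; rewrite ltxx.
pose s j := lam j + conjc (lam j).
have sE j : s j = (2 * complex.Re (lam j))%:C.
  by rewrite /s addcJ (rmorphM (real_complex R)) (rmorph_nat (real_complex R)).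
have s0 j : s j != 0.
  rewrite sE; apply/eqP => /complexI /eqP; rewrite mulf_eq0 pnatr_eq0 /=.
  by rewrite lt_eqF // lam_lt0.
have r0 : resolvent_set L 0 by apply: res.
have orth i j : lam i != lam j -> ip (xhat i) (xhat j) = 0.
  exact: (normal_eigenvectors_orthogonal hip nL r0 (lam0 j) (ev i) (ev j)).
have GE i j : Gmx ip lam xhat i j = ip (xhat i) (xhat j) / s j.
  rewrite mxE /s; have [->//|ij] := eqVneq (lam i) (lam j).
  by rewrite orth // !mul0r.
have dE x j : ip x (xhat j) =
    s j * ip (inv_shift L (conjc (lam j)) x) (xhat j).
  have rj : resolvent_set L (- conjc (lam j)).
    by apply: res; case: (lam j) (lam_lt0 j) => a b /= a0; rewrite oppr_ge0 ltW.
  have [dy yE] := inv_shift_resolvent rj x.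
  rewrite -{1}yE ipDl ipZl (normal_eigenvector_adjoint hip nL r0 (lam0 j) (ev j) dy).
  by rewrite mulrDl.
have Pip x k := P_DOP_ip (sa_indep sa) s0 GE (dE x) k.
split; first by apply: orthogonal_projection_lspan => // x; exact: P_DOP_lspan.
move=> simple unit.
have ortho i j : ip (xhat i) (xhat j) = (i == j)%:R.
  have [<-|ij] := eqVneq i j; first by rewrite -hip unit expr1n.
  apply: orth; apply: contra ij => /eqP lij.
  (* a simple eigenvalue is listed only once *)
  have /esym/eqP := has_dim_uniq (simple i).2 (sa_multiplicity sa i).
  move=> /card1P/= [k kP]; apply/eqP.
  have /eqP -> : i == k by have := kP i; rewrite !inE eqxx => <-.
  by have := kP j; rewrite !inE -lij eqxx => /esym/eqP.
split=> [i j|x].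
  rewrite GE ortho sE mulrC fmorphV /=.
  by have [->//|] := eqVneq i j; rewrite !mulr0.
(* Both sides lie in the span, so inner products with the [xhat k] decide. *)
apply: (lspan_ip_eq (ip := ip)) (P_DOP_lspan _ _ _ _ _) _ _; first by eexists.
move=> k; rewrite Pip ip_suml (bigD1 k) //= big1 ?addr0 ?ortho ?eqxx ?mulr1 //.
by move=> i /negbTE ik; rewrite ortho ik mulr0.
Qed.
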